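(* Let $K_n=(V,E)$ be the complete graph on $n$ vertices and let $e \in E$ be an edge. Then $\mathrm{rotdim}(K_n \setminus \{e\}) = n-2$, where $K_n\setminus\{e\}$ denotes the graph obtained from $K_n$ by deleting the edge $e$.
   Context: Let $G=(V,E)$ be a finite simple undirected graph with $V=\{1,\dots,n\}$. For a vertex weight $s: V \to \mathbb{R}_{\geq 0}$ and an edge length $l: E \to \mathbb{R}_{\geq 0}$, consider the optimization problem: maximize $\sum_{i \in V} s(i)\|\mathbf{v}(i)\|^2$ over all maps $\mathbf{v}: V \to \mathbb{R}^n$ subject to $\sum_{i \in V} s(i)\mathbf{v}(i) = 0$ and $\|\mathbf{v}(i)-\mathbf{v}(j)\| \leq l(ij)$ for all $ij \in E$. An optimal solution $\mathbf{v}$ is called an optimal embedding. Define $\mathrm{rotdim}_G(s,l) := \min\{\dim \mathrm{span}\{\mathbf{v}(i) : i \in V\} : \mathbf{v} \text{ an optimal embedding}\}$, and for connected $G$, $\mathrm{rotdim}(G) := \max\{\mathrm{rotdim}_G(s,l) : s: V \to \mathbb{Z}_{\geq 0},\ l: E \to \mathbb{Z}_{\geq 0}\}$ (the rotational dimension). If $G$ is disconnected, $\mathrm{rotdim}(G)$ is defined as the maximum of $\mathrm{rotdim}(C)$ over the connected components $C$ of $G$. *)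

(* Defs.v *)
From HB Require Import structures.
From mathcomp Require Import all_boot all_order all_algebra.
From mathcomp Require Import reals.

Set Implicit Arguments.
Unset Strict Implicit.
Unset Printing Implicit Defensive.

Import Order.TTheory GRing.Theory Num.Theory.

Local Open Scope ring_scope.

Record sgraph := SGraph {
  vertex :> finType;
  adj : rel vertex;
  adj_sym : symmetric adj;
  adj_irr : irreflexive adj
}.

Arguments adj : clear implicits.

Definition edges (G : sgraph) : {set {set G}} :=
  [set [set p.1; p.2] | p : G * G & adj G p.1 p.2].

Definition connectedb (G : sgraph) : bool :=
  [forall x : G, forall y : G, connect (adj G) x y].

Definition component (G : sgraph) (x : G) : {set G} :=
  [set y | connect (adj G) x y].

Section Induced.
Variables (G : sgraph) (A : {set G}).

Definition induced_adj : rel {x : G | x \in A} :=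
  fun x y => adj G (val x) (val y).

Lemma induced_sym : symmetric induced_adj.
Proof. by move=> x y; exact: adj_sym. Qed.

Lemma induced_irr : irreflexive induced_adj.
Proof. by move=> x; exact: adj_irr. Qed.

Definition induced : sgraph := SGraph induced_sym induced_irr.
End Induced.

Section DeleteEdge.
Variables (G : sgraph) (e : {set G}).

Definition delete_edge_adj : rel G :=
  fun x y => adj G x y && ([set x; y] != e).

Lemma delete_edge_sym : symmetric delete_edge_adj.
Proof. by move=> x y; rewrite /delete_edge_adj adj_sym setUC. Qed.

Lemma delete_edge_irr : irreflexive delete_edge_adj.
Proof. by move=> x; rewrite /delete_edge_adj adj_irr. Qed.

Definition delete_edge : sgraph := SGraph delete_edge_sym delete_edge_irr.
End DeleteEdge.

Section Complete.
Variable n : nat.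

Definition complete_adj : rel 'I_n := fun i j => i != j.

Lemma complete_sym : symmetric complete_adj.
Proof. by move=> i j; rewrite /complete_adj eq_sym. Qed.

Lemma complete_irr : irreflexive complete_adj.
Proof. by move=> i; rewrite /complete_adj eqxx. Qed.

Definition complete : sgraph := SGraph complete_sym complete_irr.
End Complete.

(* The Euclidean norm; the canonical norm on matrices is the sup norm. *)
Definition enorm (R : realType) (m : nat) (u : 'rV[R]_m) : R :=
  Num.sqrt (\sum_(k < m) u 0 k ^+ 2).

Section RotDim.
Variables (R : realType) (G : sgraph).

Definition embedding := G -> 'rV[R]_#|G|.

(* An edge length is given on all vertex sets, but only its values at edges
   [set i; j] are ever used. *)
Definition feasible (s : G -> R) (l : {set G} -> R) (v : embedding) : Prop :=
  \sum_(i : G) s i *: v i = 0 /\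
  forall i j : G, adj G i j -> enorm (v i - v j) <= l [set i; j].

Definition objective (s : G -> R) (v : embedding) : R :=
  \sum_(i : G) s i * enorm (v i) ^+ 2.

Definition optimal (s : G -> R) (l : {set G} -> R) (v : embedding) : Prop :=
  feasible s l v /\
  forall w : embedding, feasible s l w -> objective s w <= objective s v.

Definition embedding_dim (v : embedding) : nat := (\dim <<codom v>>%VS)%N.

Definition is_rotdim_at (s : G -> R) (l : {set G} -> R) (d : nat) : Prop :=
  (exists2 v, optimal s l v & embedding_dim v = d) /\
  forall v, optimal s l v -> (d <= embedding_dim v)%N.
End RotDim.

(* d is the maximum over i of the value specified by F i; the second clause
   also asserts that every F i specifies some value. *)
Definition is_max_over (I : Type) (F : I -> nat -> Prop) (d : nat) : Prop :=
  (exists i, F i d) /\ forall i, exists2 k, F i k & (k <= d)%N.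

Definition is_rotdim_connected (R : realType) (G : sgraph) : nat -> Prop :=
  is_max_over (fun sl : (G -> nat) * ({set G} -> nat) =>
    is_rotdim_at (R := R) (fun i => (sl.1 i)%:R) (fun a => (sl.2 a)%:R)).

Definition is_rotdim (R : realType) (G : sgraph) : nat -> Prop :=
  if connectedb G then is_rotdim_connected R G
  else is_max_over (fun x : G => is_rotdim_connected R (induced (component x))).

(* Main.v *)
Require Import Defs.
From mathcomp Require Import all_boot all_order all_algebra.
From mathcomp Require Import reals.
From mathcomp Require Import boolp classical_sets topology normedtype derive.
From mathcomp Require Import ring lra.

(* For a balanced embedding, (sum_i s_i) times the objective equals half the
   energy sum_{i,j} s_i s_j |v_i - v_j|^2, which is translation invariant.

   Upper bound: let e = ab, and rotate v_a and v_b about the affine span of the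
   other n - 2 points.  This changes no distance except |v_a - v_b|, which is
   largest when a and b lie on opposite sides of that span in a common subspace;
   the configuration then has affine dimension at most n - 2, its energy has not
   decreased, and recentring puts its linear span in the same dimension.

   Lower bound: with unit lengths and weight 1 on K_n minus b, weight 0 on b, the
   regular simplex shows that an optimal embedding realises all the distances
   within the clique, so the vectors v_i - v_a are linearly independent.

   Optimal embeddings exist by compactness: on a connected graph a balanced
   feasible embedding is bounded.  For n = 2 the graph is disconnected, with
   one-vertex components. *)

Set Implicit Arguments.
Unset Strict Implicit.
Unset Printing Implicit Defensive.

Import Order.TTheory GRing.Theory Num.Theory.
Import numFieldNormedType.Exports.
Local Open Scope ring_scope.

(** * Euclidean geometry of row vectors: projections, normals, simplices *)

Section DotProduct.
Variables (R : realType) (m : nat).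
Implicit Types (u v w : 'rV[R]_m) (X : seq 'rV[R]_m).

Definition dot u v : R := \sum_(k < m) u 0 k * v 0 k.

Lemma dotC u v : dot u v = dot v u.
Proof. by apply: eq_bigr => k _; rewrite mulrC. Qed.

Lemma dotDl u v w : dot (u + v) w = dot u w + dot v w.
Proof. by rewrite -big_split; apply: eq_bigr => k _; rewrite mxE mulrDl. Qed.

Lemma dotZl c u w : dot (c *: u) w = c * dot u w.
Proof. by rewrite mulr_sumr; apply: eq_bigr => k _; rewrite mxE mulrA. Qed.

Lemma dotNl u w : dot (- u) w = - dot u w.
Proof. by rewrite -scaleN1r dotZl mulN1r. Qed.

Lemma dot0l w : dot 0 w = 0.
Proof. by rewrite -(scale0r 0) dotZl mul0r. Qed.

Lemma dotDr u v w : dot w (u + v) = dot w u + dot w v.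
Proof. by rewrite !(dotC w) dotDl. Qed.

Lemma dotZr c u w : dot w (c *: u) = c * dot w u.
Proof. by rewrite !(dotC w) dotZl. Qed.

Lemma dotNr u w : dot w (- u) = - dot w u.
Proof. by rewrite !(dotC w) dotNl. Qed.

Lemma dot0r w : dot w 0 = 0.
Proof. by rewrite dotC dot0l. Qed.

Definition dotE := (dotDl, dotDr, dotNl, dotNr, dotZl, dotZr).

Lemma dot_suml (I : finType) (F : I -> 'rV[R]_m) w :
  dot (\sum_i F i) w = \sum_i dot (F i) w.
Proof. by apply: (big_morph (dot^~ w)) => [u v|]; rewrite ?dotDl ?dot0l. Qed.

Lemma dot_sumr (I : finType) (F : I -> 'rV[R]_m) w :
  dot w (\sum_i F i) = \sum_i dot w (F i).
Proof. by rewrite dotC dot_suml; apply: eq_bigr => i _; rewrite dotC. Qed.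

Lemma dot_ge0 u : 0 <= dot u u.
Proof. by apply: sumr_ge0 => k _; rewrite -expr2 sqr_ge0. Qed.

Lemma dot_eq0 u : (dot u u == 0) = (u == 0).
Proof.
apply/idP/eqP => [|->]; last by rewrite dot0l.
rewrite psumr_eq0 => [/allP u0|k _]; last by rewrite -expr2 sqr_ge0.
apply/rowP => k; rewrite mxE; apply/eqP.
by have := u0 k (mem_index_enum _); rewrite /= -expr2 sqrf_eq0.
Qed.

Lemma enorm_sqr u : enorm u ^+ 2 = dot u u.
Proof.
rewrite /enorm sqr_sqrtr; last by apply: sumr_ge0 => k _; rewrite sqr_ge0.
by apply: eq_bigr => k _; rewrite expr2.
Qed.

Lemma enorm_ge0 u : 0 <= enorm u.
Proof. exact: sqrtr_ge0. Qed.

Lemma enorm_le u c : 0 <= c -> (enorm u <= c) = (dot u u <= c ^+ 2).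
Proof. by move=> c0; rewrite -enorm_sqr ler_pXn2r // nnegrE enorm_ge0. Qed.

Lemma coord_le_enorm u k : `|u 0 k| <= enorm u.
Proof.
rewrite -[_ <= _](@ler_pXn2r _ 2) ?nnegrE ?enorm_ge0 // enorm_sqr.
rewrite real_normK ?num_real // /dot (bigD1 k) //= -expr2 lerDl.
by apply: sumr_ge0 => j _; rewrite -expr2 sqr_ge0.
Qed.

(** One half of Cauchy-Schwarz: the squared norm of |v| u + |u| v equals 2 |u| |v| (u.v + |u| |v|)
    and is nonnegative. Zero vectors are split off so that the factor 2 |u| |v| can be cancelled. *)
Lemma dot_ge_enorm u v : - (enorm u * enorm v) <= dot u v.
Proof.
have [->|u0] := eqVneq u 0; first by rewrite dot0l oppr_le0 mulr_ge0 ?enorm_ge0.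
have [->|v0] := eqVneq v 0; first by rewrite dot0r oppr_le0 mulr_ge0 ?enorm_ge0.
have pos w : w != 0 -> 0 < enorm w.
  by rewrite lt_def enorm_ge0 -dot_eq0 -enorm_sqr sqrf_eq0 andbT.
have := dot_ge0 (enorm v *: u + enorm u *: v).
rewrite !dotE (dotC v u) -!enorm_sqr.
set A := enorm u; set B := enorm v; set D := dot u v.
rewrite [X in 0 <= X](_ : _ = 2 * (A * B) * (D + A * B)); last by ring.
rewrite pmulr_rge0; last by rewrite !mulr_gt0 ?ltr0n // pos.
by rewrite -lerBlDr sub0r.
Qed.

Lemma dot_span w X : {in X, forall z, dot w z = 0} ->
  {in <<X>>%VS, forall z, dot w z = 0}.
Proof.
move=> wX z; rewrite -[X]in_tupleE => /coord_span ->.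
rewrite dot_sumr big1 // => i _; rewrite dotZr wX ?mulr0 //.
by rewrite mem_nth.
Qed.

(** Gram-Schmidt by induction on [X]: the projection onto the longer span adds the component of
    [w - pw] along the residual of the new vector. *)
Lemma orthogonal_projection X w : exists2 p, p \in <<X>>%VS &
  {in <<X>>%VS, forall z, dot (w - p) z = 0}.
Proof.
elim: X w => [|x X IH] w.
  exists 0; first exact: mem0v.
  by apply: dot_span.
have [px pxX ox] := IH x; have [pw pwX ow] := IH w.
have XxX : {subset <<X>>%VS <= <<x :: X>>%VS}.
  by apply/subvP; rewrite span_cons addvSr.
(* If [x] already lies in the span of [X], then [x - px = 0] and the quotient is 0 by convention, so
   no correction is made. *)
pose c := dot (w - pw) (x - px) / dot (x - px) (x - px).
exists (pw + c *: (x - px)).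
  apply: memvD; first exact: XxX.
  by apply/memvZ/memvB; [rewrite memv_span ?mem_head | exact: XxX].
have oX : {in X, forall z, dot (w - (pw + c *: (x - px))) z = 0}.
  move=> z zX; rewrite opprD addrA dotDl dotNl dotZl ox ?memv_span //.
  by rewrite ow ?memv_span // mulr0 subr0.
apply: dot_span => z; rewrite inE => /orP[/eqP->{z}|]; last exact: oX.
rewrite -[X in dot _ X](subrK px) dotDr (dot_span oX pxX) addr0.
rewrite opprD addrA dotDl dotNl dotZl /c.
have [->|x0] := eqVneq (x - px) 0; first by rewrite !dot0r mulr0 subr0.
by rewrite divfK ?dot_eq0 // subrr.
Qed.

(** By dimension count some vector lies outside the span; its residual after projection is nonzero
    and can be normalised. *)
Lemma unit_normal X : (size X < m)%N -> exists2 u, dot u u = 1 &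
  {in <<X>>%VS, forall z, dot u z = 0}.
Proof.
move=> Xm; have [w wX] : exists w, w \notin <<X>>%VS.
  have /subvPn[w _ wX] : ~~ ({:'rV[R]_m} <= <<X>>)%VS.
    apply/negP => /dimvS; rewrite dimvf /dim /= mul1n leqNgt.
    by rewrite (leq_ltn_trans (dim_span X)).
  by exists w.
have [p pX op] := orthogonal_projection X w.
have wp : w - p != 0 by apply: contraNneq wX => /subr0_eq ->.
have e0 : enorm (w - p) != 0 by rewrite -sqrf_eq0 enorm_sqr dot_eq0.
exists ((enorm (w - p))^-1 *: (w - p)) => [|z zX].
  by rewrite dotZl dotZr -enorm_sqr expr2 mulKf // mulVf.
by rewrite dotZl op // mulr0.
Qed.

(** The Gram matrix is (I + J)/2, with J the all-ones matrix. Pairing a relation with the j-th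
    vector gives c_j = -S, where S is the sum of the coefficients; summing over j gives (k + 1) S =
    0. *)
Lemma simplex_free k (X : k.-tuple 'rV[R]_m) :
  (forall i j : 'I_k, dot X`_i X`_j = (1 + (i == j)%:R) / 2) -> free X.
Proof.
move=> dX; apply/freeP => c c0.
have cE j : c j = - \sum_i c i.
  have : dot (\sum_i c i *: X`_i) X`_j = 0 by rewrite c0 dot0l.
  rewrite dot_suml.
  under eq_bigr => i _ do rewrite dotZl dX mulrA mulrDr mulr1.
  rewrite -mulr_suml big_split /= => /eqP.
  rewrite mulf_eq0 invr_eq0 pnatr_eq0 orbF addrC addr_eq0 => /eqP <-.
  rewrite (bigD1 j) //= eqxx mulr1 big1 ?addr0 // => i /negPf ->.
  by rewrite mulr0.
have : \sum_i c i = - (\sum_i c i) *+ k.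
  by rewrite {1}(eq_bigr _ (fun i _ => cE i)) sumr_const card_ord.
move=> /eqP; rewrite mulNrn -addr_eq0 -mulrS mulrn_eq0 /= => /eqP S0 j.
by rewrite cE S0 oppr0.
Qed.

End DotProduct.

(** * Objective as a translation-invariant energy *)

Section Energy.
Variables (R : realType) (G : sgraph).
Implicit Types (s : G -> R) (v w : embedding R G) (l : {set G} -> R).

Definition dist2 v (i j : G) : R := dot (v i - v j) (v i - v j).

Definition energy s v : R := \sum_i \sum_j s i * s j * dist2 v i j.

Lemma objectiveE s v : objective s v = \sum_i s i * dot (v i) (v i).
Proof. by apply: eq_bigr => i _; rewrite enorm_sqr. Qed.

Lemma objective_energy s v : \sum_i s i *: v i = 0 ->
  (\sum_i s i) * objective s v = energy s v / 2.
Proof.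
move=> sv0; rewrite objectiveE.
(* Expanding each squared distance, the cross terms assemble into twice the squared norm of the
   weighted sum, which balance makes zero. *)
have -> : energy s v = \sum_i \sum_j s i * s j * (dot (v i) (v i))
   + \sum_i \sum_j s i * s j * (dot (v j) (v j))
   - 2 * dot (\sum_i s i *: v i) (\sum_i s i *: v i).
  rewrite dot_suml mulr_sumr -big_split -sumrB; apply: eq_bigr => i _ /=.
  rewrite dot_sumr mulr_sumr -big_split -sumrB; apply: eq_bigr => j _ /=.
  by rewrite /dist2 !dotE (dotC (v j)); ring.
rewrite sv0 dot0l mulr0 subr0 [X in _ + X]exchange_big /=.
have -> : \sum_i \sum_j s i * s j * dot (v i) (v i)
     = (\sum_i s i) * \sum_i s i * dot (v i) (v i).
  rewrite mulr_sumr; apply: eq_bigr => i _; rewrite mulr_suml.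
  by apply: eq_bigr => j _; ring.
have -> : \sum_j \sum_i s i * s j * dot (v j) (v j)
     = (\sum_i s i) * \sum_i s i * dot (v i) (v i).
  rewrite mulr_sumr; apply: eq_bigr => i _; rewrite mulr_suml.
  by apply: eq_bigr => j _; ring.
by field.
Qed.

Definition recenter s v : embedding R G :=
  fun i => v i - (\sum_j s j)^-1 *: \sum_j s j *: v j.

Lemma recenterB s v i j : recenter s v i - recenter s v j = v i - v j.
Proof. by rewrite /recenter opprB addrA subrK. Qed.

Lemma energy_recenter s v : energy s (recenter s v) = energy s v.
Proof.
by apply: eq_bigr => i _; apply: eq_bigr => j _; rewrite /dist2 recenterB.
Qed.

Lemma recenter_balanced s v : \sum_i s i != 0 ->
  \sum_i s i *: recenter s v i = 0.
Proof.
move=> S0; rewrite /recenter; under eq_bigr => i _ do rewrite scalerBr.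
by rewrite sumrB -scaler_suml scalerA divff // scale1r subrr.
Qed.

Lemma recenter_feasible s l w : \sum_i s i != 0 ->
  (forall i j : G, adj G i j -> enorm (w i - w j) <= l [set i; j]) ->
  feasible s l (recenter s w).
Proof.
move=> S0 wl; split=> [|i j ij]; first exact: recenter_balanced.
by rewrite recenterB wl.
Qed.

(** The competitor [w] need not be balanced: recentring it changes neither distances nor energy. *)
Lemma energy_optimal s l v w : 0 < \sum_i s i -> optimal s l v ->
  (forall i j : G, adj G i j -> enorm (w i - w j) <= l [set i; j]) ->
  energy s w <= energy s v.
Proof.
move=> S0 [[sv _] vmax] wl.
have wf := recenter_feasible (lt0r_neq0 S0) wl.
have := vmax _ wf; rewrite -(ler_pM2l S0) !objective_energy //; last by case: wf.
by rewrite energy_recenter ler_pM2r // invr_gt0 ltr0n.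
Qed.

Lemma optimal_recenter s l v w : 0 < \sum_i s i -> optimal s l v ->
  (forall i j : G, adj G i j -> enorm (w i - w j) <= l [set i; j]) ->
  energy s v <= energy s w -> optimal s l (recenter s w).
Proof.
move=> S0 [[sv lv] vmax] wl vw.
have wf := recenter_feasible (lt0r_neq0 S0) wl.
split=> // u uf; apply: le_trans (vmax u uf) _.
rewrite -(ler_pM2l S0) !objective_energy //; last by case: wf.
by rewrite energy_recenter ler_pM2r // invr_gt0 ltr0n.
Qed.

End Energy.

(** * Upper bound: unfolding about a non-edge *)

Section Unfolding.
Variables (R : realType) (G : sgraph).
Implicit Types (s : G -> R) (v w : embedding R G) (l : {set G} -> R).

Lemma optimal0 s l : (forall i, s i = 0) ->
  (forall i j, adj G i j -> 0 <= l [set i; j]) ->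
  optimal s l (fun=> 0).
Proof.
move=> s0 l0; split=> [|w _]; last first.
  by rewrite /objective !big1 // => i _; rewrite s0 mul0r.
split=> [|i j ij]; first by rewrite big1 // => i _; rewrite scaler0.
by rewrite subrr enorm_le ?l0 // dot0l sqr_ge0.
Qed.

Lemma embedding_dim0 : embedding_dim (fun=> 0 : 'rV[R]_#|G|) = 0%N.
Proof.
apply/eqP; rewrite /embedding_dim dimv_eq0 -subv0; apply/span_subvP => z.
by move=> /codomP[i ->]; rewrite mem0v.
Qed.

(* Rotate a and b about the affine span of the other vertices until they lie on
   opposite sides of it in a common subspace. *)
Lemma unfold v (a b c : G) : a != b -> c != a -> c != b ->
  exists w, exists2 X : seq 'rV[R]_#|G|, size X = (#|G| - 2)%N &
  [/\ forall i, w i - w c \in <<X>>%VS,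
      forall i j, [set i; j] != [set a; b] -> dist2 w i j = dist2 v i j &
      forall i j, dist2 v i j <= dist2 w i j].
Proof.
move=> ab ca cb.
(* With [c] as base point, the vertices other than [a] and [b] span at most n - 3 directions. *)
pose B := [set: G] :\ a :\ b :\ c.
pose Y := [seq v i - v c | i <- enum B].
have cardB : #|G| = #|B|.+3.
  rewrite -cardsT (cardsD1 a) (cardsD1 b (_ :\ a)) (cardsD1 c (_ :\ b)) !inE.
  by rewrite eq_sym ab ca cb.
have sY : size Y = #|B| by rewrite size_map cardE.
have [|u uu uY] := @unit_normal R #|G| Y.
  by rewrite sY cardB -addn3 -addSnnS leq_addr.
have [x xY oY] := fin_all_exists2 (fun i : G =>
  orthogonal_projection Y (v i - v c)).
(* The residual orthogonal to the span of [Y]; it vanishes away from [a] and [b], being both in that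
   span and orthogonal to it. *)
pose y i := v i - v c - x i.
have y0 i : i != a -> i != b -> y i = 0.
  move=> ia ib; apply/eqP; rewrite -dot_eq0; apply/eqP.
  apply: (oY i); apply: memvB => //; have [->|ic] := eqVneq i c.
    by rewrite subrr mem0v.
  by apply/memv_span/map_f; rewrite mem_enum !inE ia ib ic.
(* Signed heights along the single direction [u]: same lengths as the residuals, opposite signs at
   [a] and [b]. Products of heights thus agree with inner products of residuals except for the pair
   [a], [b], where Cauchy-Schwarz gives the inequality. *)
pose t i := if i == a then enorm (y a) else if i == b then - enorm (y b) else 0.
have t0 i : i != a -> i != b -> t i = 0 by rewrite /t => /negPf-> /negPf->.
have tt i : t i * t i = dot (y i) (y i).
  rewrite /t; case: eqVneq => [->|ia]; first by rewrite -expr2 enorm_sqr.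
  case: eqVneq => [->|ib]; first by rewrite mulrNN -expr2 enorm_sqr.
  by rewrite mulr0 y0 // dot0l.
have tij i j : [set i; j] != [set a; b] -> t i * t j = dot (y i) (y j).
  move=> ij; have [->|nij] := eqVneq i j; first exact: tt.
  have [/andP[ia ib]|] := boolP ((i != a) && (i != b)).
    by rewrite t0 // y0 // mul0r dot0l.
  have [/andP[ja jb]|] := boolP ((j != a) && (j != b)).
    by rewrite (t0 j) // (y0 j) // mulr0 dot0r.
  rewrite !negb_and !negbK => /orP[]/eqP je /orP[]/eqP ie.
  - by rewrite ie je eqxx in nij.
  - by rewrite ie je finset.setUC eqxx in ij.
  - by rewrite ie je eqxx in ij.
  - by rewrite ie je eqxx in nij.
have tab : t a * t b <= dot (y a) (y b).
  by rewrite /t eqxx eq_sym (negPf ab) eqxx mulrN dot_ge_enorm.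
have tle i j : t i * t j <= dot (y i) (y j).
  have [eij|/tij-> //] := eqVneq [set i; j] [set a; b].
  have [->|nij] := eqVneq i j; first by rewrite tt.
  have : a \in [set i; j] by rewrite eij !inE eqxx.
  have : b \in [set i; j] by rewrite eij !inE eqxx orbT.
  rewrite !inE => /orP[]/eqP eb /orP[]/eqP ea; rewrite -?ea -?eb //.
  - by rewrite -ea in eb; rewrite eb eqxx in ab.
  - by rewrite mulrC dotC.
  - by rewrite -ea in eb; rewrite eb eqxx in ab.
pose w i := v c + x i + t i *: u.
have xx i j : dot u (x i - x j) = 0 by rewrite uY // memvB.
have yx k i j : dot (y k) (x i - x j) = 0 by apply: (oY k); rewrite memvB.
(* Pythagoras, here and for [v] below: the part inside the span is common to [v] and [w], so only
   heights and residuals need comparing. *)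
have dw i j : dist2 w i j = dot (x i - x j) (x i - x j) + (t i - t j) ^+ 2.
  have -> : dist2 w i j = dot (x i - x j + (t i - t j) *: u)
                              (x i - x j + (t i - t j) *: u).
    rewrite /dist2; congr (dot _ _); apply/rowP => k; rewrite /w /y !mxE;
    by ring.
  have := xx i j; move: (x i - x j) => p up.
  by rewrite !dotE (dotC p u) up uu; ring.
have dv i j : dist2 v i j = dot (x i - x j) (x i - x j)
    + (t i * t i + t j * t j - 2 * dot (y i) (y j)).
  have -> : dist2 v i j = dot (x i - x j + (y i - y j))
                              (x i - x j + (y i - y j)).
    rewrite /dist2; congr (dot _ _); apply/rowP => k; rewrite /w /y !mxE;
    by ring.
  have := conj (yx i i j) (yx j i j); rewrite !tt.
  move: (x i - x j) (y i) (y j) => p yi yj [yip yjp].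
  by rewrite !dotE !(dotC p) yip yjp (dotC yj yi); ring.
have wc : w c = v c.
  rewrite /w t0 // scale0r addr0.
  have := y0 c ca cb; rewrite /y subrr sub0r => /eqP; rewrite oppr_eq0.
  by move=> /eqP ->; rewrite addr0.
(* The n - 3 directions of [Y] and the one direction [u] make n - 2. *)
exists w, (u :: Y); first by rewrite /= sY cardB -addn3 -addnBA // addn1.
split=> [i|i j ij|i j].
- rewrite wc /w -(addrA (v c)) [v c + _]addrC addrK span_cons addrC.
  by apply: memv_add => //; apply: memvZ; exact: memv_line.
- by rewrite dw dv -tij //; ring.
- by rewrite dw dv; have := tle i j; nra.
Qed.

(** As [a] and [b] are not adjacent, unfolding keeps every constrained distance and cannot lower the
    energy, so recentring the result gives an optimal embedding. With total weight 0 there is no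
    barycentre, and the zero embedding serves. *)
Lemma optimal_dim_le s l v (a b c : G) : (forall i, 0 <= s i) ->
  a != b -> c != a -> c != b -> ~~ adj G a b -> optimal s l v ->
  exists2 w, optimal s l w & (embedding_dim w <= #|G| - 2)%N.
Proof.
move=> s0 ab ca cb nab vopt; have [[_ vl] _] := vopt.
have l0 i j : adj G i j -> 0 <= l [set i; j].
  by move=> ij; apply: le_trans (vl _ _ ij); exact: enorm_ge0.
have S0 : 0 <= \sum_i s i by apply: sumr_ge0.
have [Sz|Snz] := eqVneq (\sum_i s i) 0.
  exists (fun=> 0); last by rewrite embedding_dim0.
  by apply: optimal0 => // i; apply: (psumr_eq0P _ Sz).
have [w [X sX [wX wd vw]]] := unfold v ab ca cb.
have Sp : 0 < \sum_i s i by rewrite lt_def Snz.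
exists (recenter s w).
  apply: (optimal_recenter Sp vopt) => [i j ij|].
    rewrite enorm_le ?l0 // -[dot _ _]/(dist2 w i j) wd.
      by rewrite -[_ <= _]enorm_le ?l0 // vl.
    apply: contraNneq nab => eij.
    have : a \in [set i; j] by rewrite eij !inE eqxx.
    have : b \in [set i; j] by rewrite eij !inE eqxx orbT.
    rewrite !inE => /orP[]/eqP eb /orP[]/eqP ea; subst; rewrite ?eqxx // in ab *.
    by rewrite adj_sym.
  apply: ler_sum => i _; apply: ler_sum => j _.
  by rewrite ler_wpM2l // mulr_ge0.
rewrite -sX; apply: leq_trans (dim_span X).
apply/dimvS/span_subvP => _ /codomP[i ->].
have rX k : recenter s w i - recenter s w k \in <<X>>%VS.
  rewrite recenterB -[w i](subrK (w c)) -addrA -[w c - w k]opprB.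
  by apply: memvB => //; rewrite wX.
(* Balance makes each recentred vector a weighted mean of its differences with the others, so a span
   containing all differences contains the vectors themselves. *)
have -> : recenter s w i = (\sum_j s j)^-1 *:
    \sum_j s j *: (recenter s w i - recenter s w j).
  under [X in _ = _ *: X]eq_bigr => j _ do rewrite scalerBr.
  rewrite sumrB recenter_balanced // subr0 -scaler_suml scalerA mulVf //.
  by rewrite scale1r.
by apply: memvZ; apply: memv_suml => j _; apply: memvZ.
Qed.

End Unfolding.

(** * Lower bound: rigidity of a clique *)

Section Clique.
Variables (R : realType) (G : sgraph).

Lemma clique_dim_ge (K : {set G}) (v : embedding R G) :
  {in K &, forall i j, i != j -> adj G i j} ->
  optimal (fun i => (i \in K)%:R) (fun=> 1) v ->
  (#|K|.-1 <= embedding_dim v)%N.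
Proof.
move=> Kcl vopt; case: (set_0Vmem K) => [->|[a aK]]; first by rewrite cards0.
have [[_ vl] _] := vopt; set s := fun i => _ in vopt.
have s0 i : 0 <= s i by rewrite ler0n.
have Sp : 0 < \sum_i s i.
  by rewrite (bigD1 a) //= /s aK ltr_pwDl ?ltr01 // sumr_ge0.
(* Orthonormal vectors are at distance sqrt 2, hence the scaling to a regular simplex with unit
   edges. *)
pose w (i : G) : 'rV[R]_#|G| := (Num.sqrt 2)^-1 *: delta_mx 0 (enum_rank i).
have ee (i j : G) : dot (delta_mx 0 (enum_rank i)) (delta_mx 0 (enum_rank j))
    = (i == j)%:R :> R.
  rewrite /dot (bigD1 (enum_rank i)) //= !mxE !eqxx /= mul1r big1 => [|k ki].
    by rewrite addr0 (inj_eq enum_rank_inj).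
  by rewrite !mxE (negPf ki) mul0r.
have ww (i j : G) : dot (w i) (w j) = 2^-1 * (i == j)%:R.
  rewrite /w dotZl dotZr ee mulrA -expr2 exprVn sqr_sqrtr //.
have dw (i j : G) : dist2 w i j = (i != j)%:R.
  rewrite /dist2; have := conj (ww i i) (conj (ww j j) (ww i j)).
  move: (w i) (w j) => p q [pp [qq pq]].
  rewrite !dotE (dotC q p) pp qq pq !eqxx.
  by case: (i == j) => /=; field.
have vle (i j : G) : 0 <= s i * s j * (dist2 w i j - dist2 v i j).
  rewrite dw /s; case: (boolP (i \in K)) => iK; last by rewrite !mul0r.
  case: (boolP (j \in K)) => jK; last by rewrite mulr0 mul0r.
  rewrite !mul1r; have [->|ij] := eqVneq i j.
    by rewrite /dist2 [v j - _]subrr dot0l subr0 ler0n.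
  by have := vl _ _ (Kcl _ _ iK jK ij); rewrite enorm_le // expr1n subr_ge0.
have vw : energy s w <= energy s v.
  apply: energy_optimal vopt _ => // i j _.
  rewrite enorm_le // -[dot _ _]/(dist2 w i j) dw expr1n.
  by case: (i != j).
(* The feasible simplex has energy at most that of [v], while each term is nonnegative by the length
   constraints; so the sum is 0, and every term vanishes. *)
have D0 : \sum_i \sum_j s i * s j * (dist2 w i j - dist2 v i j) = 0.
  apply/eqP; rewrite eq_le; apply/andP; split; last first.
    by apply: sumr_ge0 => i _; apply: sumr_ge0.
  rewrite -subr_le0 in vw; apply: le_trans vw; rewrite /energy -sumrB.
  apply: ler_sum => i _; rewrite -sumrB; apply: ler_sum => j _.
  by rewrite mulrBr.
have dv (i j : G) : i \in K -> j \in K -> dist2 v i j = (i != j)%:R.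
  move=> iK jK; rewrite -dw; apply/eqP; rewrite eq_sym -subr_eq0.
  have D1 := psumr_eq0P (fun i _ => sumr_ge0 _ (fun j _ => vle i j)) D0 (i := i) isT.
  have := psumr_eq0P (fun j _ => vle i j) D1 (i := j) isT.
  by rewrite /s iK jK !mul1r => ->.
pose X := [tuple v (enum_val i) - v a | i < #|K :\ a|].
have -> : #|K|.-1 = size X by rewrite size_tuple (cardsD1 a K) aK.
have Xi (i : 'I_#|K :\ a|) : X`_i = v (enum_val i) - v a.
  by rewrite -tnth_nth tnth_mktuple.
(* Polarisation turns the unit distances within [K] into the inner products required by
   [simplex_free]. *)
have /eqP <- : free X.
  apply: simplex_free => i j; rewrite !Xi.
  have := enum_valP i; have := enum_valP j; rewrite !in_setD1.
  move=> /andP[ja jK] /andP[ia iK].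
  have := dv _ _ iK jK; have := dv _ _ iK aK; have := dv _ _ jK aK.
  rewrite ia ja (inj_eq enum_val_inj).
  have -> : dist2 v (enum_val i) (enum_val j) =
      dot (v (enum_val i) - v a - (v (enum_val j) - v a))
          (v (enum_val i) - v a - (v (enum_val j) - v a)).
    by rewrite opprB addrA subrK.
  rewrite /dist2; move: (v (enum_val i) - v a) (v (enum_val j) - v a).
  move=> p q qq pp.
  rewrite dotDl dotNl !dotDr !dotNr (dotC q p) qq pp.
  by case: (i == j) => /=; lra.
apply/dimvS/span_subvP => _ /mapP[i _ ->].
by apply: memvB; apply/memv_span/codom_f.
Qed.

End Clique.

(** * Attainment of the minimal dimension and existence of optimal embeddings *)

Lemma is_rotdim_at_le (R : realType) (G : sgraph) (s : G -> R)
    (l : {set G} -> R) (v : embedding R G) :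
  optimal s l v ->
  exists2 k, is_rotdim_at s l k & (k <= embedding_dim v)%N.
Proof.
move=> vopt.
(* Classical reflection makes this a boolean predicate, so that the least dimension can be taken by
   [ex_minnP]. *)
pose P k :=
  `[< exists2 w : embedding R G, optimal s l w & embedding_dim w = k >].
have P_dim w : optimal s l w -> P (embedding_dim w).
  by move=> wo; apply/asboolP; exists w.
have exP : exists k, P k by exists (embedding_dim v); exact: P_dim.
case: (ex_minnP exP) => k /asboolP Pk kmin; exists k; last exact/kmin/P_dim.
by split=> // w /P_dim /kmin.
Qed.

Section Existence.
Variables (R : realType) (G : sgraph).
Implicit Types (s : G -> R) (v w : embedding R G) (l : {set G} -> R).

(** The sum of all |l A| bounds every edge length, so coordinates of two vertices joined by a simple
    path differ by at most |G| times it. Balance then turns bounds on differences into bounds on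
    coordinates. *)
Lemma coord_bounded s l w i k : connectedb G -> (forall i, 0 <= s i) ->
  0 < \sum_i s i -> feasible s l w ->
  `|w i 0 k| <= #|G|%:R * \sum_A `|l A|.
Proof.
move=> Gc s0 Sp [sw lw]; set L := \sum_A _.
have L0 : 0 <= L by apply: sumr_ge0.
have wadj x y : adj G x y -> `|w x 0 k - w y 0 k| <= L.
  move=> xy; have := coord_le_enorm (w x - w y) k; rewrite !mxE => /le_trans; apply.
  apply: le_trans (lw _ _ xy) _; apply: le_trans (ler_norm _) _.
  by rewrite /L (bigD1 [set x; y]) //= lerDl sumr_ge0.
have wpath x p : path (adj G) x p ->
    `|w x 0 k - w (last x p) 0 k| <= (size p)%:R * L.
  elim: p x => [|y p IH] x /=; first by rewrite subrr normr0 mul0r.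
  move=> /andP[xy /IH yp]; rewrite -(subrKA (w y 0 k)) mulrSr mulrDl mul1r.
  by apply: le_trans (ler_normD _ _) _; rewrite addrC lerD // wadj.
have wdiff x y : `|w x 0 k - w y 0 k| <= #|G|%:R * L.
  have /connectP[p xp ->] : connect (adj G) x y.
    by move: Gc => /forallP/(_ x)/forallP/(_ y).
  case: (shortenP xp) => q xq /card_uniqP /= xqU _.
  apply: le_trans (wpath _ _ xq) _; rewrite ler_wpM2r // ler_nat.
  by apply: ltnW; rewrite -xqU max_card.
rewrite -(ler_pM2l Sp) -[X in X * `|_|]gtr0_norm // -normrM.
(* The subtracted sum of the s_j w_j is zero by balance. *)
have -> : (\sum_j s j) * w i 0 k = \sum_j s j * (w i 0 k - w j 0 k).
  have /rowP/(_ k) := sw; rewrite summxE mxE => sw0.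
  rewrite -[LHS]subr0 -[X in _ - X]sw0 mulr_suml -sumrB.
  by apply: eq_bigr => j _; rewrite mxE mulrBr.
rewrite mulr_suml; apply: le_trans (ler_norm_sum _ _ _) _.
by apply: ler_sum => j _; rewrite normrM ger0_norm // ler_wpM2l.
Qed.

Lemma optimal_exists s l : connectedb G -> (forall i, 0 <= s i) ->
  (forall A, 0 <= l A) -> exists v, optimal s l v.
Proof.
move=> Gc s0 l0; have S0 : 0 <= \sum_i s i by apply: sumr_ge0.
have [Sz|Snz] := eqVneq (\sum_i s i) 0.
  by exists (fun=> 0); apply: optimal0 => // i; apply: (psumr_eq0P _ Sz).
have Sp : 0 < \sum_i s i by rewrite lt_def Snz.
(* Embeddings are flattened into one row vector so that compactness of boxes and continuity of
   coordinates apply; [emb] decodes and [code] encodes. *)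
pose T := 'rV[R]_(#|G| * #|G|).
pose emb (x : T) : embedding R G := fun i => row (enum_rank i) (vec_mx x).
pose code w : T := mxvec (\matrix_(i < #|G|) w (enum_val i)).
have codeK w : emb (code w) = w.
  by apply/funext => i; rewrite /emb mxvecK rowK enum_rankK.
have emb_cont i k : continuous (fun x : T => emb x i 0 k).
  have -> : (fun x : T => emb x i 0 k) =
      fun x : T => x 0 (mxvec_index (enum_rank i) k).
    by apply/funext => x; rewrite !mxE.
  exact: coord_continuous.
have sum_cont (I : finType) (F : I -> T -> R) : (forall i, continuous (F i)) ->
    continuous (fun x => \sum_i F i x).
  by move=> Fc; apply: continuous_big => [|i _]; [exact: add_continuous|exact: Fc].
have dot_cont (f g : T -> 'rV[R]_#|G|) : (forall k, continuous (fun x => f x 0 k)) ->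
    (forall k, continuous (fun x => g x 0 k)) ->
    continuous (fun x => dot (f x) (g x)).
  by move=> fc gc; apply: sum_cont => k x; exact: cvgM (fc k x) (gc k x).
have diff_cont i j k : continuous (fun x : T => (emb x i - emb x j) 0 k).
  have -> : (fun x : T => (emb x i - emb x j) 0 k) =
      fun x : T => emb x i 0 k - emb x j 0 k by apply/funext => x; rewrite !mxE.
  by move=> x; exact: cvgB (emb_cont i k x) (emb_cont j k x).
pose A : set T := [set x | feasible s l (emb x)]%classic.
have A_closed : closed A.
  (* Squaring the length constraints, legitimate as [l] is nonnegative, makes them polynomial in the
     coordinates; the feasible set is an intersection of closed preimages. *)
  have -> : A = ((\bigcap_(k in [set: 'I_#|G|])
        (fun x : T => (\sum_i s i *: emb x i) 0 k) @^-1` [set t | t = 0%R]) `&`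
      (\bigcap_(p in [set p : G * G | adj G p.1 p.2])
        (fun x => dist2 (emb x) p.1 p.2) @^-1`
          [set t | (t <= l [set p.1; p.2]%SET ^+ 2)%R]))%classic.
    apply/seteqP; split=> x /=.
      move=> [xs xl]; split=> [k _ /=|[i j] /= ij].
        by rewrite xs mxE.
      by rewrite -[_ <= _]enorm_le //; exact: xl.
    move=> [xs xl]; split=> [|i j ij].
      by apply/rowP => k; rewrite (xs k) ?mxE.
    by rewrite enorm_le //; exact: (xl (i, j)).
  apply: closedI; [apply: closed_bigI => k _|apply: closed_bigI => -[i j] _].
    apply: (continuous_closedP _).1; last exact: closed_eq.
    have -> : (fun x : T => (\sum_i s i *: emb x i) 0 k) =
        fun x : T => \sum_i s i * emb x i 0 k.
      by apply/funext => x; rewrite summxE; apply: eq_bigr => i _; rewrite mxE.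
    by apply: sum_cont => i x; exact: cvgM (cvg_cst _) (emb_cont i k x).
  apply: (continuous_closedP _).1; last exact: closed_le.
  by apply: dot_cont => k; exact: diff_cont.
pose D := #|G|%:R * \sum_A `|l A|.
have A_compact : compact A.
  have box := rV_compact (fun _ : 'I_(#|G| * #|G|) => @segment_compact R (- D) D).
  apply: subclosed_compact A_closed box _ => x xA /= j.
  case/mxvec_indexP: j => i k.
  have := coord_bounded (enum_val i) k Gc s0 Sp xA.
  by rewrite /emb enum_valK !mxE in_itv /= ler_norml.
have A_nonempty : (A !=set0)%classic.
  exists (code (fun=> 0)); rewrite /A /= codeK; split=> [|i j ij].
    by rewrite big1 // => i _; rewrite scaler0.
  by rewrite subrr enorm_le // dot0l sqr_ge0.
have obj_cont : {within A, continuous (fun x => objective s (emb x))}%classic.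
  apply: continuous_subspaceT.
  have -> : (fun x => objective s (emb x)) =
      fun x => \sum_i s i * dot (emb x i) (emb x i).
    by apply/funext => x; exact: objectiveE.
  apply: sum_cont => i x.
  exact: cvgM (cvg_cst _) (dot_cont _ _ (emb_cont i) (emb_cont i) x).
have [x xA xmax] := compact_EVT_max A_nonempty A_compact obj_cont.
exists (emb x); split; first by move: xA; rewrite inE.
by move=> w wf; have := xmax (code w); rewrite codeK inE /A /= codeK; apply.
Qed.

End Existence.

(** * One-vertex graphs and the computation for the complete graph minus an edge *)

Lemma is_rotdim_connected_subsingleton (R : realType) (G : sgraph) :
  (forall i j : G, i = j) -> is_rotdim_connected R G 0.
Proof.
move=> G1.
have rd0 (sl : (G -> nat) * ({set G} -> nat)) :
    is_rotdim_at (R := R) (fun i => (sl.1 i)%:R) (fun A => (sl.2 A)%:R) 0.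
  split=> //; exists (fun=> 0); last exact: embedding_dim0.
  split=> [|w [sw _]].
    split=> [|i j ij]; first by rewrite big1 // => i _; rewrite scaler0.
    by rewrite subrr enorm_le // dot0l sqr_ge0.
  (* With a single vertex, balance reads s_i w_i = 0, so every feasible objective is 0 and the zero
     embedding is optimal. *)
  rewrite !objectiveE [leRHS]big1 => [|i _]; last by rewrite dot0l mulr0.
  rewrite big1 // => i _; rewrite -dotZl; move: sw; rewrite (bigD1 i) //= big1.
    by rewrite addr0 => ->; rewrite dot0l.
  by move=> j /eqP[]; exact: G1.
by split=> [|sl]; [exists (fun=> 0%N, fun=> 0%N)|exists 0%N].
Qed.

Theorem theorem3p5 (R : realType) (n : nat) (e : {set complete n})
    (he : e \in edges (complete n)) :
  is_rotdim R (delete_edge e) (n - 2)%N.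
Proof.
have [[a b] /= ab ->] := imsetP he; move: ab; rewrite inE /= => ab {e he}.
set G := delete_edge _.
have cG : #|G| = n by rewrite card_ord.
have ab2 : #|[set a; b]| = 2 by rewrite cards2 (_ : a != b).
(* A vertex [c] outside the deleted edge exists unless n = 2. It serves as the base point for
   unfolding and, being adjacent to every other vertex, shows connectedness. *)
have [c cab|G2] := pickP (fun c : G => c \notin [set a; b]); last first.
  have eT : [set a; b] = [set: 'I_n].
    by apply/setP => c; have /negbFE := G2 c; rewrite [in RHS]inE.
  have nE : n = 2 by rewrite -ab2 eT cardsT card_ord.
  (* Two distinct vertices already exhaust the vertex set, so their pair is the deleted edge. *)
  have nadj (i j : G) : adj G i j = false.
    apply/negbTE/negP => /andP[ij] /eqP; apply; apply/eqP.
    by rewrite eT eqEcard finset.subsetT cardsT card_ord cards2 (_ : i != j) // nE.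
  have conn (i j : G) : connect (adj G) i j -> i = j.
    by move=> /connectP[[|k p] // /andP[]]; rewrite nadj.
  rewrite /is_rotdim ifF; last first.
    apply/negP => /forallP/(_ a)/forallP/(_ b)/conn abE.
    by move: ab; rewrite /complete_adj abE eqxx.
  have sub (x : G) : is_rotdim_connected R (induced (component x)) 0.
    apply: is_rotdim_connected_subsingleton => -[i /= xi] [j /= xj].
    by apply: val_inj => /=; move: xi xj; rewrite !inE => /conn <- /conn.
  have -> : (n - 2 = 0)%N by rewrite nE.
  by split=> [|x]; [exists a|exists 0%N].
move: cab; rewrite !inE negb_or => /andP[ca cb].
have adjc (x : G) : x != c -> adj G x c && adj G c x.
  move=> xc; rewrite [adj G c x]adj_sym andbb; apply/andP; split=> //.
  apply/eqP => /setP/(_ c); rewrite !inE eqxx orbT.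
  by rewrite (negPf ca) (negPf cb).
have Gc : connectedb G.
  have cc (x : G) : connect (adj G) x c && connect (adj G) c x.
    have [->|/adjc/andP[xc cx]] := eqVneq x c; first by rewrite connect0.
    by rewrite !connect1.
  apply/forallP => x; apply/forallP => y.
  have /andP[xc _] := cc x; have /andP[_ cy] := cc y.
  exact: connect_trans xc cy.
have nab : ~~ adj G a b by rewrite /= /delete_edge_adj eqxx andbF.
rewrite /is_rotdim Gc.
(* Used twice: for the bound over all weights and lengths, and to obtain the value [k] at the
   extremal data below. *)
have upper (sl : (G -> nat) * ({set G} -> nat)) :
    exists2 k, is_rotdim_at (R := R) (fun i => (sl.1 i)%:R)
                 (fun A => (sl.2 A)%:R) k & (k <= n - 2)%N.
  have [|||v vopt] := @optimal_exists R G (fun i => (sl.1 i)%:R)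
    (fun A => (sl.2 A)%:R) => //.
  have [//|w wopt wn] := @optimal_dim_le R G _ _ v a b c _ ab ca cb nab vopt.
  have [k kat kw] := is_rotdim_at_le wopt.
  by exists k => //; rewrite -cG (leq_trans kw).
split=> //.
(* The vertices other than [b] form a clique of size n - 1, since the deleted edge contains [b];
   weight 0 on [b] makes the weights the indicator of that clique. *)
pose sl : (G -> nat) * ({set G} -> nat) :=
  (fun i => i \in [set~ b] : nat, fun=> 1%N).
exists sl; have [k kat kn] := upper sl.
suff <- : k = (n - 2)%N by [].
apply/eqP; rewrite eqn_leq kn /=; have [[v vopt <-] _] := kat.
have -> : (n - 2)%N = #|[set~ (b : G)]|.-1 by rewrite cardsC1 cG subn2.
apply: clique_dim_ge vopt => i j; rewrite !inE => ib jb ij.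
apply/andP; split=> //; apply/eqP => /setP/(_ b).
by rewrite !inE eqxx orbT !(eq_sym b) (negPf ib) (negPf jb).
Qed.
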